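(* Let $k \geq 1$ be an integer. Then $$\mathrm{hc}(A_{2k}) = \tfrac{2}{3}(k-1)(6k^3+2k^2-4k-3), \qquad \mathrm{hc}(A_{2k+1}) = \tfrac{4}{3}k(k+1)(3k^2+k-1)+1.$$
   Context: For a connected graph $G$ of order $n$, the detour distance $D(u,v)$ is the length of a longest $u$–$v$ path (in a tree, the ordinary distance). A hamiltonian coloring of $G$ is a map $h: V(G)\to\{0,1,2,\ldots\}$ with $D(u,v)+|h(u)-h(v)|\geq n-1$ for all distinct $u,v$; its span is $\max\{|h(u)-h(v)|\}$, and $\mathrm{hc}(G)$ is the minimum span over all hamiltonian colorings. The trees $A_d$ (introduced by Bala et al. via a recursive drawing) are explicitly: $A_{2k}$ ($k\ge1$) consists of two adjacent vertices $w,w'$ and, for each $c\in\{w,w'\}$, a path $c=h^c_0,h^c_1,\ldots,h^c_{k-1}$ together with, for each $0\le i\le k-2$, two pendant paths with $k-1-i$ new vertices each, attached at $h^c_i$ (all these vertices distinct); thus $A_2=K_2$, $A_{2k}$ has $2k^2$ vertices and diameter $2k-1$. $A_{2k+1}$ ($k\ge1$) consists of a vertex $w$, two pendant paths with $k$ new vertices each attached at $w$, two further paths $w=h^s_0,h^s_1,\ldots,h^s_k$ for $s\in\{L,R\}$ sharing only $w$, and, for each $s\in\{L,R\}$ and each $1\le i\le k-1$, two pendant paths with $k-i$ new vertices each attached at $h^s_i$; thus $A_3=K_{1,4}$, $A_{2k+1}$ has $2k(k+1)+1$ vertices and diameter $2k$. *)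

(* Defs.v *)
From mathcomp Require Export all_boot all_order all_algebra.
From mathcomp Require Import boolp.

Set Implicit Arguments.
Unset Strict Implicit.
Unset Printing Implicit Defensive.

Record cgraph := CGraph {
  vertex :> finType;
  edge : rel vertex;
  edge_sym : symmetric edge;
  edge_irr : irreflexive edge;
  edge_conn : forall u v, connect edge u v
}.

Definition upath (G : cgraph) (u v : G) (p : seq G) : bool :=
  [&& path (@edge G) u p, last u p == v & uniq (u :: p)].

(* A path without repeated vertices has fewer than #|G| edges, so bounding the
   length m by #|G| excludes no path. *)
Definition detour (G : cgraph) (u v : G) : nat :=
  \max_(m < #|G| | [exists p : m.-tuple G, upath u v p]) m.

Definition hamiltonian_coloring (G : cgraph) (h : G -> nat) : Prop :=
  forall u v : G, u != v ->
    #|G| - 1 <= detour u v + `|h u - h v|%N.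

Definition coloring_span (G : cgraph) (h : G -> nat) : nat :=
  \max_(u : G) \max_(v : G) `|h u - h v|%N.

Definition achieves_span (G : cgraph) (m : nat) : Prop :=
  exists h : G -> nat, hamiltonian_coloring h /\ coloring_span h = m.

Lemma achieves_span_ex (G : cgraph) : exists m, `[< achieves_span G m >].
Proof.
pose h (u : G) := #|G| * enum_rank u.
exists (coloring_span h); apply/asboolP; exists h; split=> // u v neq_uv.
apply: leq_trans (leq_subr _ _) (leq_trans _ (leq_addl _ _)).
have neq: enum_rank u != enum_rank v :> nat.
  by apply: contra neq_uv => /eqP/val_inj/enum_rank_inj->.
rewrite /h !PoszM -GRing.mulrBr abszM absz_nat leq_pmulr //.
by rewrite absz_gt0 GRing.subr_eq0.
Qed.

Definition hc (G : cgraph) : nat := ex_minn (achieves_span_ex G).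

Section Symmetrize.
Variables (T : finType) (arc : rel T).

Definition sym_arc (u v : T) : bool := arc u v || arc v u.

Lemma sym_arc_sym : symmetric sym_arc.
Proof. by move=> u v; rewrite /sym_arc /= orbC. Qed.

Lemma sym_arc_irr (depth : T -> nat) :
  (forall u v, arc u v -> depth u < depth v) -> irreflexive sym_arc.
Proof.
move=> arcd u; rewrite /sym_arc orbb.
by apply/negP=> /arcd; rewrite ltnn.
Qed.

Lemma sym_arc_conn (depth : T -> nat) :
  (forall u v, arc u v -> depth u < depth v) ->
  (forall u v, (exists x, arc x u) \/ (exists x, arc x v) \/ u = v) ->
  forall u v, connect sym_arc u v.
Proof.
move=> arcd par u v.
have [m] := ubnP (depth u + depth v); elim: m u v => // m IHm u v lt_m.
have [[x xu]|[[x xv]|->]] := par u v; last exact: connect0.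
- have ux: sym_arc u x by rewrite /sym_arc xu orbT.
  apply: connect_trans (connect1 ux) _; apply: IHm.
  by rewrite -ltnS; apply: leq_trans lt_m; rewrite ltnS ltn_add2r arcd.
- have xv': sym_arc x v by rewrite /sym_arc xv.
  apply: connect_trans (connect1 xv'); apply: IHm.
  by rewrite -ltnS; apply: leq_trans lt_m; rewrite ltnS ltn_add2l arcd.
Qed.

End Symmetrize.

(* The building block shared by both families: a path h_0, ..., h_(k-1) with,
   for each i <= k-2, two pendant paths with k-1-i new vertices attached at h_i.
   [inl i] is h_i; [inr (existT i (b, j))] is the vertex at distance j+1 from
   h_i on its pendant path b. *)
Definition branch (k : nat) : finType :=
  ('I_k + {i : 'I_k.-1 & (bool * 'I_(k.-1 - i))%type})%type.

Definition branch_root (k : nat) (x : branch k) : bool :=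
  if x is inl i then i == 0 :> nat else false.

(* All arcs below are oriented away from the centre, one per edge. *)
Definition branch_arc (k : nat) (x y : branch k) : bool :=
  match x, y with
  | inl i, inl i' => i' == i.+1 :> nat
  | inl i, inr q => (tag q == i :> nat) && ((tagged q).2 == 0 :> nat)
  | inr q, inr q' => [&& tag q' == tag q, (tagged q').1 == (tagged q).1
                       & (tagged q').2 == (tagged q).2.+1 :> nat]
  | inr _, inl _ => false
  end.

Definition branch_depth (k : nat) (x : branch k) : nat :=
  match x with inl i => i | inr q => tag q + (tagged q).2.+1 end.

Lemma branch_arc_depth (k : nat) (x y : branch k) :
  branch_arc x y -> branch_depth x < branch_depth y.
Proof.
case: x y => [i|q] [i'|q'] //=.
- by move/eqP->.
- by case/andP=> /eqP<- _; rewrite addnS ltnS leq_addr.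
- by case/and3P=> /eqP e _ /eqP->; rewrite e ltn_add2l.
Qed.

Lemma branch_parent (k : nat) (x : branch k) :
  (exists y, branch_arc y x) \/ branch_root x.
Proof.
case: x => [[[|i] lt_i]|[i [b [[|j] lt_j]]]] /=; first by right.
- by left; exists (inl (Ordinal (ltnW lt_i))) => /=.
- left; exists (inl (Ordinal (leq_trans (ltn_ord i) (leq_pred k)))) => /=.
  by rewrite !eqxx.
- left; exists (inr (Tagged (fun i : 'I_k.-1 => (bool * 'I_(k.-1 - i))%type)
    (b, Ordinal (ltnW lt_j)))).
  by rewrite /= !eqxx.
Qed.

Lemma branch_root_inj (k : nat) (x y : branch k) :
  branch_root x -> branch_root y -> x = y.
Proof.
by case: x y => [i|q] [i'|q'] //= /eqP i0 /eqP i'0; congr inl; apply: val_inj;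
   rewrite /= i0 i'0.
Qed.

(* A_(2k): two branches with their roots w, w' joined by an edge. *)
Definition Aeven_vertex (k : nat) : finType := (bool * branch k)%type.

Definition Aeven_arc (k : nat) (u v : Aeven_vertex k) : bool :=
  (u.1 == v.1) && branch_arc u.2 v.2
  || [&& ~~ u.1, v.1, branch_root u.2 & branch_root v.2].

Definition Aeven_depth (k : nat) (u : Aeven_vertex k) : nat :=
  u.1 + branch_depth u.2.

Lemma Aeven_arc_depth (k : nat) (u v : Aeven_vertex k) :
  Aeven_arc u v -> Aeven_depth u < Aeven_depth v.
Proof.
case: u v => c x [c' y]; rewrite /Aeven_arc /Aeven_depth /=.
case/orP=> [/andP[/eqP-> /branch_arc_depth]|]; first by rewrite ltn_add2l.
by case/and4P=> /negPf-> -> x0 y0; rewrite (branch_root_inj x0 y0) ltn_add2r.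
Qed.

Lemma Aeven_parent (k : nat) (u v : Aeven_vertex k) :
  (exists x, Aeven_arc x u) \/ (exists x, Aeven_arc x v) \/ u = v.
Proof.
have par c (x : branch k) :
    (exists y, Aeven_arc y (c, x)) \/ (c = false /\ branch_root x).
  have [[y yx]|x0] := branch_parent x.
    by left; exists (c, y); rewrite /Aeven_arc /= eqxx yx.
  by case: c; [left; exists (false, x); rewrite /Aeven_arc /= x0 | right].
case: u v => c x [c' y].
have [|[-> x0]] := par c x; first by left.
have [|[-> y0]] := par c' y; first by right; left.
by right; right; rewrite (branch_root_inj x0 y0).
Qed.

Definition Aeven (k : nat) : cgraph :=
  CGraph (@sym_arc_sym _ (@Aeven_arc k))
    (sym_arc_irr (@Aeven_arc_depth k))
    (sym_arc_conn (@Aeven_arc_depth k) (@Aeven_parent k)).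

(* A_(2k+1): [None] is w; [Some (inl (b, j))] is the vertex at distance j+1 from
   w on the pendant path b; [Some (inr (s, x))] lies in the branch s, whose
   spine vertex of index i is h^s_(i+1), so that the k-1-i of [branch] is the
   prescribed k-(i+1). *)
Definition Aodd_vertex (k : nat) : finType :=
  option (bool * 'I_k + bool * branch k)%type.

Definition Aodd_arc (k : nat) (u v : Aodd_vertex k) : bool :=
  match u, v with
  | None, Some (inl q) => q.2 == 0 :> nat
  | None, Some (inr q) => branch_root q.2
  | Some (inl p), Some (inl q) => (p.1 == q.1) && (q.2 == p.2.+1 :> nat)
  | Some (inr p), Some (inr q) => (p.1 == q.1) && branch_arc p.2 q.2
  | _, _ => false
  end.

Definition Aodd_depth (k : nat) (u : Aodd_vertex k) : nat :=
  match u with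
  | None => 0
  | Some (inl q) => q.2.+1
  | Some (inr q) => (branch_depth q.2).+1
  end.

Lemma Aodd_arc_depth (k : nat) (u v : Aodd_vertex k) :
  Aodd_arc u v -> Aodd_depth u < Aodd_depth v.
Proof.
case: u v => [[p|p]|] [[q|q]|] //=.
- by case/andP=> _ /eqP->.
- by case/andP=> _ /branch_arc_depth.
Qed.

Lemma Aodd_parent (k : nat) (u v : Aodd_vertex k) :
  (exists x, Aodd_arc x u) \/ (exists x, Aodd_arc x v) \/ u = v.
Proof.
have par (x : Aodd_vertex k) : (exists y, Aodd_arc y x) \/ x = None.
  case: x => [[[b [[|j] lt_j]]|[s x]]|]; [| | |by right]; left.
  - by exists None.
  - by exists (Some (inl (b, Ordinal (ltnW lt_j)))) => /=; rewrite !eqxx.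
  - have [[y yx]|x0] := branch_parent x; last by exists None.
    by exists (Some (inr (s, y))) => /=; rewrite eqxx.
have [|->] := par u; first by left.
by have [|->] := par v; [right; left | right; right].
Qed.

Definition Aodd (k : nat) : cgraph :=
  CGraph (@sym_arc_sym _ (@Aodd_arc k))
    (sym_arc_irr (@Aodd_arc_depth k))
    (sym_arc_conn (@Aodd_arc_depth k) (@Aodd_parent k)).

(* Main.v *)
(** Let L u be the distance from u to the nearest centre (w, or w and w') and
    let e be 1 in the even case, 0 in the odd case.  Then D(u,v) <= L u + L v + e,
    with equality as soon as a u-v path must run through the centre.  Listing the
    vertices by increasing colour and summing the n-1 consecutive constraints
    bounds the span below by (n-1)^2 - e(n-1) - 2 sum L + (L first + L last).
    The bound is attained by a list that alternates between the two halves of the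
    tree and has its two ends as central as possible: any two vertices that are
    not consecutive in the list get colours at least n-2 apart, because two gaps
    add up to at least 2(n-1) - 2 diam >= n-2. *)

Require Import Defs.
From mathcomp Require Import all_boot all_order all_algebra.
From mathcomp Require Import boolp zify lra.

Set Implicit Arguments.
Unset Strict Implicit.
Unset Printing Implicit Defensive.

(** * Detour distances, bounded above and below through depth functions *)

Section Detour.
Variable G : cgraph.
Implicit Types (u v x y : G) (p : seq G).

Lemma upath_size_le_detour u v p : upath u v p -> size p <= detour u v.
Proof.
move=> up; have [_ _ /card_uniqP /= cardp] := and3P up.
have lt_p : size p < #|G| by rewrite -cardp max_card.
rewrite (bigmax_sup (Ordinal lt_p)) //.
by apply/existsP; exists (in_tuple p).
Qed.

Lemma detour_leP u v m :
  (forall p, upath u v p -> size p <= m) -> detour u v <= m.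
Proof.
move=> le_m; apply/bigmax_leqP=> i /existsP[p /le_m].
by rewrite size_tuple.
Qed.

Lemma upath_exists u v : exists p, upath u v p.
Proof.
have /connectP[p ep ->] := edge_conn u v.
case/shortenP: ep => p' ep' up' _.
by exists p'; apply/and3P; split.
Qed.

Lemma detour_gt0 u v : u != v -> 0 < detour u v.
Proof.
move=> neq_uv; have [p up] := upath_exists u v.
apply: leq_trans (upath_size_le_detour up).
by case: p up => // /and3P[_ /= /eqP uv]; rewrite uv eqxx in neq_uv.
Qed.

Lemma upath_rev u v p : upath u v p -> exists2 q, upath v u q & size q = size p.
Proof.
case/and3P=> ep /eqP lp up; exists (rev (belast u p)); last first.
  by rewrite size_rev size_belast.
apply/and3P; split.
- by rewrite -lp rev_path (@eq_path _ _ (@edge G)) // => x y; apply: edge_sym.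
- by case: p lp {ep up} => [|x p] /= lp; rewrite ?rev_cons ?last_rcons // lp.
- by rewrite -lp -rev_rcons -lastI rev_uniq.
Qed.

Lemma detour_sym u v : detour u v = detour v u.
Proof.
apply/eqP; rewrite eqn_leq; apply/andP; split; apply: detour_leP => p.
  by case/upath_rev=> q uq <-; apply: upath_size_le_detour.
by case/upath_rev=> q uq <-; apply: upath_size_le_detour.
Qed.

(* Every u-v walk is at least as long as the variation of a 1-Lipschitz f, and
   some simple path exists. *)
Lemma lipschitz_le_detour (f : G -> nat) u v :
  (forall x y, edge x y -> f y <= (f x).+1) -> f v <= f u + detour u v.
Proof.
move=> lip; have [p up] := upath_exists u v.
have le_f : f v <= f u + size p.
  case/and3P: up => ep /eqP<- _; elim: p u ep => [|x p IHp] u /=.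
    by rewrite addn0.
  by case/andP=> /lip fx /IHp; lia.
by apply: leq_trans le_f _; rewrite leq_add2l upath_size_le_detour.
Qed.

Section RootedDepth.
Variable d : G -> nat.
Hypothesis edge_depth : forall x y, edge x y -> d y = (d x).+1 \/ d x = (d y).+1.
Hypothesis parent_unique : forall x y z,
  edge x z -> edge y z -> d x < d z -> d y < d z -> x = y.

(** Once a simple path has stepped away from the root it can never turn back: a step towards the
    root would lead to the unique parent, which is the vertex just left. *)
Lemma descending_path_depth u x p :
  path (@edge G) u (x :: p) -> uniq (u :: x :: p) -> d x = (d u).+1 ->
  d (last x p) = d u + (size p).+1.
Proof.
elim: p u x => [|y p IHp] u x; first by move=> _ _ /= ->; rewrite addn1.
move=> /= /and3P[ux xy yp] /andP[nu un] dx.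
have [dy|dy] := edge_depth xy.
  by rewrite (IHp x y) //= ?xy ?yp // dx addSnnS.
have yu : y = u.
  by apply: (@parent_unique y u x); rewrite // 1?edge_sym //; lia.
by rewrite yu !inE eqxx orbT in nu.
Qed.

(** A simple path in a rooted tree first climbs, then descends. Each climbing step uses up one unit
    of [d u], and from the first descending step on the length is a difference of depths. *)
Lemma detour_le_depth u v : detour u v <= d u + d v.
Proof.
apply: detour_leP => p /and3P[ep /eqP<-].
elim: p u ep => [//|x p IHp] u ep un.
have /= /andP[ux xp] := ep.
have [dx|du] := edge_depth ux.
  by rewrite /= (descending_path_depth ep un dx); lia.
have /= /andP[_ /(IHp _ xp)] := un.
by rewrite /= du; lia.
Qed.

End RootedDepth.
End Detour.

(** * Spans, and the lower bound on the span of any hamiltonian coloring *)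

Lemma coloring_le_span (G : cgraph) (h : G -> nat) u v :
  `|h u - h v|%N <= coloring_span h.
Proof. by rewrite (bigmax_sup u) // (bigmax_sup v). Qed.

Lemma hc_eqP (G : cgraph) m :
  (forall h : G -> nat, hamiltonian_coloring h -> m <= coloring_span h) ->
  (exists2 h : G -> nat, hamiltonian_coloring h & coloring_span h <= m) ->
  hc G = m.
Proof.
move=> lb [h hamh leh]; rewrite /hc; case: ex_minnP => c /asboolP[h' [ham' <-]].
move=> /(_ (coloring_span h)) min; apply/eqP; rewrite eqn_leq lb // andbT.
by apply: leq_trans leh; apply: min; apply/asboolP; exists h.
Qed.

Section LowerBound.
Variables (G : cgraph) (L : G -> nat) (e : nat).
Hypothesis detour_le : forall u v, detour u v <= L u + L v + e.

(** Summing the consecutive constraints telescopes [h]. Each inner vertex contributes its [L] twice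
    and the two ends only once, so the ends reappear on the left to complete the doubled sum. *)
Lemma coloring_path_le (h : G -> nat) x s :
  path (fun u v => #|G|.-1 + h u <= h v + L u + L v + e) x s ->
  h x + #|G|.-1 * size s + L x + L (last x s)
    <= h (last x s) + 2 * (\sum_(y <- x :: s) L y) + e * size s.
Proof.
elim: s x => [|y s IHs] x /=; first by rewrite big_seq1; lia.
by case/andP=> hy /IHs; rewrite [X in _ -> _ <= _ + 2 * X + _]big_cons /= !mulnS; lia.
Qed.

(** The vertices are sorted by colour. The constant [c] stays abstract because the least value of
    [L] summed over two distinct vertices depends on the family: 0 for two central vertices, 1 when
    the centre is unique. *)
Lemma span_ge (h : G -> nat) (c : nat) : 1 < #|G| ->
  (forall u v, u != v -> c <= L u + L v) -> hamiltonian_coloring h ->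
  #|G|.-1 * #|G|.-1 + c
    <= coloring_span h + 2 * (\sum_x L x) + e * #|G|.-1.
Proof.
move=> G_gt1 Lc ham.
pose r := [rel u v : G | h u <= h v].
have rtr : transitive r by move=> ? ? ?; apply: leq_trans.
have rto : total r by move=> ? ?; apply: leq_total.
have := sort_sorted rto (enum G).
have ps : perm_eq (sort r (enum G)) (enum G) by rewrite perm_sort.
have := sort_uniq r (enum G); rewrite enum_uniq.
move: ps; case: (sort r _) => [|x s] ps us ss.
  by have := perm_size ps; rewrite -cardE => /= G0; rewrite -G0 in G_gt1.
have szs : #|G| = (size s).+1 by have := perm_size ps; rewrite -cardE.
have pR : path (fun u v => #|G|.-1 + h u <= h v + L u + L v + e) x s.
  (* The coloring condition only concerns distinct vertices, so neighbours in the sorted list must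
     be known to differ. *)
  have : path [rel u v | (u != v) && r u v] x s.
    rewrite /= in ss us; move: us ss; rewrite (path_sortedE rtr) => us.
    clear -us rtr; elim: s x us => //= y s IHs x /andP[nx us] /andP[/andP[xy xs] ss].
    rewrite xy andbT; apply/andP; split.
      by apply: contra nx => /eqP->; rewrite inE eqxx.
    by apply: IHs => //; rewrite -(path_sortedE rtr).
  apply: sub_path => u v /= /andP[neq le]; move: (ham u v neq) (detour_le u v).
  by set n := #|G|; lia.
have sumL : \sum_(y <- x :: s) L y = \sum_y L y.
  by rewrite (perm_big _ ps) /= big_enum.
have := coloring_path_le pR; rewrite sumL szs succnK.
have neq : x != last x s.
  case: s {pR ss ps sumL} us szs => [|y s] us szs; first by rewrite szs in G_gt1.
  by case/andP: us => nx _; apply: contra nx => /= /eqP->; apply: mem_last.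
have := Lc _ _ neq; have := coloring_le_span h (last x s) x; lia.
Qed.

End LowerBound.

(** * Upper bound: a coloring read off from a list of the vertices *)

Section UpperBound.
Variables (G : cgraph) (L : G -> nat) (e K : nat) (x0 : G) (s : seq G).
Hypothesis L_le : forall u, L u <= K.
(** Two consecutive gaps involve four values of [L] and two of [e], so this makes them add up to at
    least [#|G| - 2]. *)
Hypothesis K_small : 4 * K + 2 * e <= #|G|.
Hypothesis G_gt1 : 1 < #|G|.
Hypothesis s_perm : perm_eq (x0 :: s) (enum G).
Hypothesis s_path : path (fun u v => L u + L v + e <= detour u v) x0 s.

Let at_ i := nth x0 (x0 :: s) i.
(** The subtraction never truncates, as [gap_sum] shows: [2 * K + e] is at most half of [#|G|],
    hence at most [#|G|.-1]. *)
Let gap i := #|G|.-1 - (L (at_ i) + L (at_ i.+1) + e).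
Let H m := \sum_(i < m) gap i.

Definition path_coloring (u : G) : nat := H (index u (x0 :: s)).

Let size_s : size s = #|G|.-1.
Proof. by have := perm_size s_perm; rewrite -cardE /= => <-. Qed.

Let gap_sum i : gap i + L (at_ i) + L (at_ i.+1) + e = #|G|.-1.
Proof. by rewrite /gap; move: (L_le (at_ i)) (L_le (at_ i.+1)); lia. Qed.

Let HS m : H m.+1 = H m + gap m.
Proof. by rewrite /H big_ord_recr. Qed.

(** The telescoping of [coloring_path_le], now with equality since the gaps are chosen tight. *)
Let H_sum m :
  H m + 2 * (\sum_(i < m.+1) L (at_ i)) + e * m
    = #|G|.-1 * m + L (at_ 0) + L (at_ m).
Proof.
elim: m => [|m IHm]; first by rewrite /H big_ord0 big_ord_recr big_ord0 /=; lia.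
have := gap_sum m; move: IHm.
by rewrite HS [in X in _ -> _ -> X]big_ord_recr !mulnS /=; lia.
Qed.

Let H_mono : {homo H : m p / m <= p}.
Proof.
move=> m p /subnKC<-; elim: (p - m) => [|q IHq]; first by rewrite addn0.
by apply: leq_trans IHq _; rewrite addnS HS leq_addr.
Qed.

Let mem_s u : u \in x0 :: s.
Proof. by rewrite (perm_mem s_perm) mem_enum. Qed.

Lemma path_coloring_hamiltonian : hamiltonian_coloring path_coloring.
Proof.
suff gap_ok u v : index u (x0 :: s) < index v (x0 :: s) ->
    #|G|.-1 + path_coloring u <= path_coloring v + detour u v.
  move=> u v neq_uv.
  case: (ltngtP (index u (x0 :: s)) (index v (x0 :: s))) => [lt|lt|eq].
  - by have := gap_ok _ _ lt; lia.
  - by have := gap_ok _ _ lt; rewrite detour_sym; lia.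
  - by rewrite -(nth_index x0 (mem_s u)) eq nth_index ?mem_s ?eqxx in neq_uv.
move=> lt_uv; have lt_v : index v (x0 :: s) < (size s).+1.
  by rewrite -[(size s).+1]/(size (x0 :: s)) index_mem.
rewrite /path_coloring; set i := index u _ in lt_uv *; set j := index v _ in lt_uv lt_v *.
have at_i : at_ i = u by rewrite /at_ nth_index.
have at_j : at_ j = v by rewrite /at_ nth_index.
have [lt_ij|] := ltnP i.+1 j; last first.
  move=> le_ji; have ej : j = i.+1 by lia.
  have lt_is : i < size s by rewrite -ltnS -ej.
  have le_d : L (at_ i) + L (at_ i.+1) + e <= detour (at_ i) (at_ i.+1).
    exact: (pathP x0 s_path i lt_is).
  by rewrite -at_i -at_j ej HS; have := gap_sum i; lia.
have neq_uv : u != v by apply: contraTneq lt_uv => uv; rewrite /i /j uv ltnn.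
(* For non-consecutive entries two gaps already give [#|G| - 2], and the detour distance of distinct
   vertices supplies the missing 1. *)
have le_H : H i.+2 <= H j by apply: H_mono.
move: le_H (detour_gt0 neq_uv) (gap_sum i) (gap_sum i.+1).
move: (L_le (at_ i)) (L_le (at_ i.+1)) (L_le (at_ i.+2)).
by rewrite !HS; lia.
Qed.

Lemma path_coloring_span :
  coloring_span path_coloring + 2 * (\sum_x L x) + e * #|G|.-1
    <= #|G|.-1 * #|G|.-1 + L x0 + L (last x0 s).
Proof.
have := H_sum #|G|.-1.
have -> : \sum_(i < #|G|.-1.+1) L (at_ i) = \sum_x L x.
  have <- : \sum_(y <- x0 :: s) L y = \sum_x L x.
    by rewrite (perm_big _ s_perm) /= big_enum.
  by rewrite (big_nth x0) big_mkord -size_s.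
have -> : at_ #|G|.-1 = last x0 s by rewrite /at_ -size_s nth_last.
have -> : at_ 0 = x0 by [].
suff : coloring_span path_coloring <= H #|G|.-1 by lia.
have le_H u : path_coloring u <= H #|G|.-1.
  by apply: H_mono; rewrite -size_s -ltnS -[(size s).+1]/(size (x0 :: s)) index_mem.
apply/bigmax_leqP=> u _; apply/bigmax_leqP=> v _.
by move: (le_H u) (le_H v); lia.
Qed.

End UpperBound.

(** * Alternating lists, and the exact value of [hc] they give *)

Section Interleave.
Variable T : eqType.
Implicit Types (a b : seq T).

Fixpoint interleave a b : seq T :=
  match a, b with
  | x :: a', y :: b' => x :: y :: interleave a' b'
  | _, _ => [::]
  end.

Lemma interleave_perm a b : size a = size b -> perm_eq (interleave a b) (a ++ b).
Proof.
elim: a b => [|x a IHa] [|y b] //= [/IHa eq_ab].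
rewrite perm_cons (perm_trans _ (permEl (perm_catCA [:: y] a b))) //=.
by rewrite perm_cons.
Qed.

Lemma interleave_last z y a b :
  size a = size b -> last z b = y -> a != [::] -> last z (interleave a b) = y.
Proof.
elim: a b z => [|x a IHa] [|y' b] z //= [sz] yb _.
case: a b IHa sz yb => [|x' a] [|y'' b] //= IHa sz yb.
exact: (IHa (y'' :: b) y').
Qed.

(** Every step after the first passes between [a] and [b], in one direction or the other; only the
    first step involves [z]. *)
Lemma interleave_path (R : rel T) z a b :
  {in a & b, forall x y, R x y /\ R y x} ->
  (forall x, x \in a -> R z x) -> path R z (interleave a b).
Proof.
elim: a b z => [|x a IHa] [|y b] z //= Rab Rz.
have [Rxy _] := Rab x y (mem_head _ _) (mem_head _ _).
rewrite Rz ?mem_head // Rxy IHa // => [x' y' ax' by'|x' ax'].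
  by apply: Rab; rewrite inE ?ax' ?by' orbT.
by have [] := Rab x' y; rewrite ?inE ?ax' ?eqxx ?orbT.
Qed.

End Interleave.

(** Taking [c] in [span_ge] to be the value of [L] summed over the ends of the list makes the lower
    bound meet the span of [path_coloring]. *)
Lemma hc_formula (G : cgraph) (L : G -> nat) (e K : nat) (x0 : G) (s : seq G) :
  1 < #|G| -> (forall u, L u <= K) -> 4 * K + 2 * e <= #|G| ->
  (forall u v, detour u v <= L u + L v + e) ->
  perm_eq (x0 :: s) (enum G) ->
  path (fun u v => L u + L v + e <= detour u v) x0 s ->
  (forall u v, u != v -> L x0 + L (last x0 s) <= L u + L v) ->
  hc G + 2 * (\sum_x L x) + e * #|G|.-1
    = #|G|.-1 * #|G|.-1 + (L x0 + L (last x0 s)).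
Proof.
move=> G_gt1 L_le K_small det_le s_perm s_path ends_min.
have span := path_coloring_span L_le K_small G_gt1 s_perm.
set h := path_coloring L e x0 s in span *.
have ham : hamiltonian_coloring h by apply: path_coloring_hamiltonian s_path.
have -> : hc G = coloring_span h; last first.
  by have := span_ge det_le G_gt1 ends_min ham; lia.
apply: hc_eqP; last by exists h.
by move=> h' ham'; have := span_ge det_le G_gt1 ends_min ham'; lia.
Qed.

(** The two halves are copies of [T]. One is listed with [t0] first and the other in reverse order,
    so the alternating list has the two copies of [t0] as its ends. *)
Lemma alternating_enum (T : finType) (V : eqType) (emb : bool -> T -> V)
    (R : rel V) (t0 : T) :
  (forall t t', R (emb false t) (emb true t') /\ R (emb true t') (emb false t)) ->
  exists s, [/\ perm_eq (emb false t0 :: s) [seq emb p.1 p.2 | p : bool * T],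
    path R (emb false t0) s & last (emb false t0) s = emb true t0].
Proof.
move=> Remb; pose l := t0 :: rem t0 (enum T).
have l_perm : perm_eq l (enum T) by rewrite perm_sym perm_to_rem // mem_enum.
pose a := map (emb false) (behead l); pose b := map (emb true) (rev l).
have sz_ab : size (emb false t0 :: a) = size b by rewrite /= !size_map size_rev.
have last_ab := interleave_last (z := emb false t0) (y := emb true t0) sz_ab _ isT.
have perm_ab := interleave_perm sz_ab.
have Rab : {in emb false t0 :: a & b, forall x y, R x y /\ R y x}.
  by move=> _ _ /(mapP (s := l))[t _ ->] /mapP[t' _ ->].
exists (behead (interleave (emb false t0 :: a) b)).
have b_last : last (emb false t0) b = emb true t0.
  by rewrite /b /l rev_cons map_rcons last_rcons.
move: sz_ab (last_ab b_last) perm_ab Rab.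
case def_b: b => [//|y b'] sz_ab lst prm Rab; split => //.
- rewrite (perm_trans prm) // -def_b.
  have prm2 : perm_eq (map (pair false) l ++ map (pair true) l) (enum {: bool * T}).
    apply: uniq_perm; last 2 first.
    - exact: enum_uniq.
    - move=> [c t]; rewrite mem_enum mem_cat.
      have lt : t \in l by rewrite (perm_mem l_perm) mem_enum.
      by apply/orP; case: c; [right|left]; apply: map_f.
    have ul : uniq l by rewrite (perm_uniq l_perm) enum_uniq.
    rewrite cat_uniq !map_inj_uniq ?ul => [|? ? []//|? ? []//]; rewrite andbT andTb.
    by apply/hasPn => _ /mapP[t _ ->]; apply/mapP => -[].
  rewrite perm_sym (perm_trans (y := map (fun p => emb p.1 p.2)
    (map (pair false) l ++ map (pair true) l))) //.
    by rewrite perm_sym perm_map.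
  rewrite map_cat -!map_comp; apply: perm_cat; first exact: perm_refl.
  by rewrite perm_map // perm_sym perm_rev.
- rewrite /=; have [-> _] := Rab _ _ (mem_head _ _) (mem_head _ _).
  apply: interleave_path => [x z ax bz|x ax].
    by apply: Rab; rewrite inE ?ax ?bz orbT.
  by have [] := Rab x y; rewrite ?inE ?ax ?eqxx ?orbT.
Qed.

(** * Counting the vertices of a branch by depth *)

Section Branch.
Variable k : nat.
Implicit Types x y z : branch k.

Lemma branch_arc_depthS x y :
  branch_arc x y -> branch_depth y = (branch_depth x).+1.
Proof.
case: x y => [i|q] [i'|q'] //=.
- by move/eqP.
- by case/andP=> /eqP; lia.
- by case/and3P=> /eqP eq_tag _ /eqP->; rewrite addnS eq_tag.
Qed.

Lemma branch_arc_inj x y z : branch_arc x z -> branch_arc y z -> x = y.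
Proof.
case: x y z => [i|[i [b j]]] [i'|[i' [b' j']]] [l|[l [c m]]] //=.
- by move=> /eqP-> /eqP[/val_inj->].
- by move=> /andP[/eqP li _] /andP[/eqP li' _]; congr inl; apply: val_inj; rewrite /= -li.
- by move=> /andP[_ /eqP->] /and3P[_ _ /eqP].
- by move=> /and3P[_ _ /eqP->] /andP[_ /eqP].
- move=> /and3P[/eqP el /eqP-> /eqP em] /and3P[/eqP el' /eqP-> /eqP em'].
  subst i i'; congr inr; congr existT; congr pair; apply: val_inj.
  by move: em'; rewrite em => -[].
Qed.

Lemma branch_rootE x : branch_root x = (branch_depth x == 0).
Proof. by case: x => [i|q] //=; rewrite addnS. Qed.

Lemma branch_depth_lt x : branch_depth x < k.
Proof. case: x => [i|[i [b j]]] //=; have := ltn_ord i; have := ltn_ord j; lia. Qed.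

(** At depth [d] there are [2 * d + 1] vertices: one on the spine, and two on the pendant paths
    attached at each of the [d] earlier spine vertices. *)
Lemma sum_branch_depth (f : nat -> nat) : 0 < k ->
  \sum_(x : branch k) f (branch_depth x) = \sum_(d < k) (2 * d + 1) * f d.
Proof.
case: k => // m _; rewrite big_sumType /=.
have -> : \sum_(i : {i : 'I_m & (bool * 'I_(m - i))%type})
    f (tag i + (tagged i).2.+1) = \sum_(d < m) 2 * d.+1 * f d.+1.
  transitivity (\sum_(i < m) \sum_(q : bool * 'I_(m - i)) f (i + q.2.+1)).
    by rewrite sig_big_dep.
  transitivity (\sum_(i < m) 2 * \sum_(j < m - i) f (i + j.+1)).
    apply: eq_bigr => i _.
    rewrite -(pair_big xpredT xpredT (fun (_ : bool) (j : 'I_(m - i)) => f (i + j.+1))) /=.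
    by rewrite big_bool mul2n -addnn.
  (* Passing from [m] to [m.+1] lengthens each pendant path by one vertex and adds two paths of one
     vertex, giving [2 * m.+1] new vertices, all at depth [m.+1]. *)
  elim: m => [|m IHm]; first by rewrite !big_ord0.
  rewrite [RHS]big_ord_recr /= -IHm big_ord_recr /= subSnn big_ord1 addn1.
  under eq_bigr => i _ do rewrite subSn 1?ltnW // big_ord_recr /= addnS subnKC 1?ltnW // mulnDr.
  rewrite big_split sum_nat_const card_ord /=.
  set X := \sum_(i < m) _; set Y := f m.+1; nia.
under [RHS]eq_bigr => d _ do rewrite mulnDl mul1n.
rewrite [RHS]big_split /= [RHS]addnC; congr (_ + _).
by rewrite [RHS]big_ord_recl /= muln0 mul0n add0n.
Qed.

Lemma card_branch : 0 < k -> #|branch k| = k ^ 2.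
Proof.
move=> k_gt0; rewrite -sum1_card (sum_branch_depth (fun=> 1)) //.
by elim: {k_gt0}k => [|m IHm]; rewrite ?big_ord0 // big_ord_recr /= IHm; lia.
Qed.

End Branch.

(** * The trees with two central vertices *)

Section Even.
Variable k : nat.
Implicit Types u v x y z : Aeven k.

Let L u : nat := branch_depth u.2.

Lemma Aeven_edgeP u v : edge u v ->
  (u.1 = v.1 /\ (branch_arc u.2 v.2 \/ branch_arc v.2 u.2)) \/
  [/\ u.1 = ~~ v.1, branch_root u.2 & branch_root v.2].
Proof.
case: u v => c x [c' y]; rewrite /edge /= /sym_arc /Aeven_arc /=.
case/orP=> /orP[/andP[/eqP-> a]|/and4P[]]; rewrite ?a; [by left; auto| |by left; auto|].
  by case: c c' => [] [] // _ _ ? ?; right.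
by case: c c' => [] [] // _ _ ? ?; right.
Qed.

Lemma detour_Aeven_le u v : detour u v <= L u + L v + 1.
Proof.
(* [d] is the distance to the centre on the side of [u]; rooting the tree at a
   fixed centre would only give [L u + L v + 2] on the other side. *)
pose d x : nat := (x.1 != u.1) + L x.
suff : detour u v <= d u + d v by rewrite /d eqxx; lia.
apply: detour_le_depth => [x y|x y z].
  case/Aeven_edgeP=> [[e1 [|] /branch_arc_depthS e2]|[e1]].
  - by left; rewrite /d /L e1 e2 addnS.
  - by right; rewrite /d /L e1 e2 addnS.
  - rewrite !branch_rootE /d /L e1 => /eqP-> /eqP->.
    by case: (y.1) (u.1) => [] []; auto.
case/Aeven_edgeP=> [[xz [ax|/branch_arc_depthS ax]]|[xz x0 z0]];
  case/Aeven_edgeP=> [[yz [ay|/branch_arc_depthS ay]]|[yz y0 z0']]; rewrite /d /L ?xz ?yz.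
- move=> _ _; case: x y xz yz ax ay => [c x] [c' y] /= -> -> ax ay.
  by rewrite (branch_arc_inj ax ay).
- lia.
- by move: z0'; rewrite branch_rootE (branch_arc_depthS ax).
- lia.
- lia.
- lia.
- by move: z0; rewrite branch_rootE (branch_arc_depthS ay).
- lia.
- case: x y xz yz x0 y0 => [c x] [c' y] /= -> -> x0 y0 _ _.
  by rewrite (branch_root_inj x0 y0).
Qed.

Lemma detour_Aeven_ge u v : u.1 != v.1 -> L u + L v + 1 <= detour u v.
Proof.
wlog: u v / ~~ u.1 && v.1.
  move=> wl neq; case: (boolP (u.1)) => u1; last by apply: wl => //; lia.
  by rewrite detour_sym [L u + _]addnC; apply: wl; rewrite 1?eq_sym //; lia.
move=> /andP[/negPf u1 v1] _.
(* A position along an axis through the centre, shifted by [k] to stay in [nat]. The central edge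
   joins the values [k] and [k + 1], so [f] is 1-Lipschitz and varies by [L u + L v + 1]. *)
pose f x := if x.1 then k + 1 + L x else k - L x.
have lip x y : edge x y -> f y <= (f x).+1.
  move=> /Aeven_edgeP xy; have := branch_depth_lt x.2; have := branch_depth_lt y.2.
  rewrite /f /L; case: xy => [[-> [|] /branch_arc_depthS ->]|[->]];
    try by case: ifP; lia.
  by rewrite !branch_rootE => /eqP-> /eqP->; case: (y.1) => /=; lia.
have := lipschitz_le_detour u v lip; rewrite /f u1 v1.
by have := branch_depth_lt u.2; rewrite -/(L u); lia.
Qed.

Lemma card_Aeven : 0 < k -> #|Aeven k| = 2 * k ^ 2.
Proof. by move=> k_gt0; rewrite card_prod card_bool card_branch. Qed.

(** The list runs from one central vertex to the other, so its ends contribute 0. *)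
Lemma hc_Aeven : 0 < k ->
  hc (Aeven k) + 4 * (\sum_(d < k) (2 * d + 1) * d) + (2 * k ^ 2).-1
    = (2 * k ^ 2).-1 * (2 * k ^ 2).-1.
Proof.
move=> k_gt0; pose r : branch k := inl (Ordinal k_gt0).
have [|s [s_perm s_path s_last]] := @alternating_enum (branch k) (Aeven k)
    (fun b t => (b, t)) (fun u v => L u + L v + 1 <= detour u v) r.
  by move=> x y; split; apply: detour_Aeven_ge.
have cardG := card_Aeven k_gt0.
have := @hc_formula (Aeven k) L 1 k.-1 (false, r) s.
have -> : \sum_x L x = 2 * \sum_(d < k) (2 * d + 1) * d.
  rewrite -(sum_branch_depth id k_gt0).
  rewrite -(pair_big xpredT xpredT (fun (_ : bool) (x : branch k) => branch_depth x)) /=.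
  by rewrite big_bool mul2n -addnn.
rewrite s_last cardG /L /= mulnA mul1n !addn0; apply => //.
- by nia.
- by move=> u; have := branch_depth_lt u.2; lia.
- by nia.
- exact: detour_Aeven_le.
- rewrite (perm_trans s_perm) //.
  by rewrite /image_mem (eq_map (g := id)) ?map_id // => -[].
Qed.

End Even.

(** * The trees with one central vertex *)

Section Odd.
Variable k : nat.
Implicit Types u v x y z : Aodd k.

(** Each side consists of one pendant path at the centre and one branch; the value at the centre is
    an arbitrary choice. *)
Definition Aodd_side u : bool :=
  match u with
  | None => false
  | Some (inl q) => q.1
  | Some (inr q) => q.1
  end.

Lemma Aodd_arc_depthS u v :
  Aodd_arc u v -> Aodd_depth v = (Aodd_depth u).+1.
Proof.
case: u v => [[p|p]|] [[q|q]|] //=.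
- by case/andP=> _ /eqP->.
- by case/andP=> _ /branch_arc_depthS->.
- by move/eqP->.
- by rewrite branch_rootE => /eqP->.
Qed.

Lemma Aodd_arc_side u v :
  Aodd_arc u v -> u = None \/ Aodd_side u = Aodd_side v.
Proof.
case: u v => [[p|p]|] [[q|q]|] //=; try by left.
- by case/andP=> /eqP->; right.
- by case/andP=> /eqP->; right.
Qed.

Lemma Aodd_arc_inj x y z : Aodd_arc x z -> Aodd_arc y z -> x = y.
Proof.
case: x y z => [[[b i]|[b p]]|] [[[b' i']|[b' p']]|] [[[c l]|[c q]]|] //=.
- by move=> /andP[/eqP-> /eqP->] /andP[/eqP-> /eqP[/val_inj->]].
- by move=> /andP[_ /eqP->].
- by move=> /andP[/eqP-> a] /andP[/eqP-> a']; rewrite (branch_arc_inj a a').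
- by move=> /andP[_ /branch_arc_depthS]; rewrite branch_rootE => ->.
- by move=> /eqP-> /andP[].
- by rewrite branch_rootE => /eqP q0 /andP[_ /branch_arc_depthS]; rewrite q0.
Qed.

Lemma Aodd_depth_le u : Aodd_depth u <= k.
Proof. by case: u => [[q|q]|] //=; exact: branch_depth_lt. Qed.

Lemma Aodd_depth_gt0 u : u != None -> 0 < Aodd_depth u.
Proof. by case: u => [[]|]. Qed.

Lemma detour_Aodd_le u v : detour u v <= Aodd_depth u + Aodd_depth v + 0.
Proof.
rewrite addn0; apply: detour_le_depth => [x y|x y z].
  by case/orP=> /Aodd_arc_depthS; auto.
case/orP=> [xz|/Aodd_arc_depthS]; last by lia.
case/orP=> [yz _ _|/Aodd_arc_depthS]; last by lia.
exact: Aodd_arc_inj xz yz.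
Qed.

Lemma detour_Aodd_ge u v : (u == None) || (Aodd_side u != Aodd_side v) ->
  Aodd_depth u + Aodd_depth v + 0 <= detour u v.
Proof.
rewrite addn0 => uv.
pose f x := if Aodd_side x then k + Aodd_depth x else k - Aodd_depth x.
have lip_arc x y : Aodd_arc x y -> f y <= (f x).+1 /\ f x <= (f y).+1.
  move=> xy; have := Aodd_depth_le y; rewrite /f (Aodd_arc_depthS xy).
  have [->|->] := Aodd_arc_side xy; last by case: ifP; lia.
  by rewrite /=; case: ifP; lia.
have lip x y : edge x y -> f y <= (f x).+1 by case/orP=> /lip_arc[].
(* Both directions are taken because [f] may increase or decrease from [u] to [v]; at the centre it
   equals [k]. *)
move: (lipschitz_le_detour u v lip) (lipschitz_le_detour v u lip).
rewrite (detour_sym v u) /f; move: (Aodd_depth_le u) (Aodd_depth_le v).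
case/orP: uv => [/eqP->|] /=; first by case: ifP; lia.
by case: (Aodd_side u) (Aodd_side v) => [] []; lia.
Qed.

Lemma card_Aodd : 0 < k -> #|Aodd k| = 2 * k * k.+1 + 1.
Proof.
move=> k_gt0; rewrite card_option card_sum !card_prod card_bool card_ord.
by rewrite card_branch //; lia.
Qed.

(** At depth [d.+1] the two branches have [2 * (2 * d + 1)] vertices and the two pendant paths at
    the centre have 2, in all [4 * d.+1]. *)
Lemma sum_Aodd_depth : 0 < k ->
  \sum_(u : Aodd k) Aodd_depth u = \sum_(d < k) 4 * d.+1 ^ 2.
Proof.
move=> k_gt0.
have -> : \sum_(u : Aodd k) Aodd_depth u = \sum_(q : bool * 'I_k) q.2.+1
    + \sum_(q : bool * branch k) (branch_depth q.2).+1.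
  rewrite (bigD1 None) //= add0n (reindex_omap Some id) => [|[]] //=.
  by rewrite big_sumType /=; congr (_ + _); apply: eq_bigl => q; rewrite eqxx.
rewrite -(pair_big xpredT xpredT (fun (_ : bool) (i : 'I_k) => i.+1)).
rewrite -(pair_big xpredT xpredT
  (fun (_ : bool) (x : branch k) => (branch_depth x).+1)) /= !big_bool /=.
rewrite (sum_branch_depth succn k_gt0) -!big_split /=.
by apply: eq_bigr => d _; lia.
Qed.

(** The centre is put in front of an alternating list that ends at one of its neighbours. The ends
    contribute 0 + 1, which is least possible since only the centre has depth 0; this is the final
    [+ 1]. *)
Lemma hc_Aodd : 0 < k ->
  hc (Aodd k) + 2 * (\sum_(d < k) 4 * d.+1 ^ 2) = (2 * k * k.+1) ^ 2 + 1.
Proof.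
move=> k_gt0; pose t0 : 'I_k + branch k := inl (Ordinal k_gt0).
pose emb b (t : 'I_k + branch k) : Aodd k :=
  match t with inl i => Some (inl (b, i)) | inr x => Some (inr (b, x)) end.
have [|s [s_perm s_path s_last]] := @alternating_enum _ _ emb
    (fun u v => Aodd_depth u + Aodd_depth v + 0 <= detour u v) t0.
  by move=> [i|x] [j|y]; split; apply: detour_Aodd_ge.
have cardG := card_Aodd k_gt0.
have := @hc_formula (Aodd k) (@Aodd_depth k) 0 k None (emb false t0 :: s).
rewrite (sum_Aodd_depth k_gt0) /= s_last cardG mul0n !addn0 add0n addn1 /=.
move=> ->.
- by lia.
- by nia.
- exact: Aodd_depth_le.
- by nia.
- exact: detour_Aodd_le.
- apply: uniq_perm.
  + rewrite cons_uniq (perm_mem s_perm) (perm_uniq s_perm) map_inj_uniq.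
      rewrite enum_uniq andbT; apply/mapP=> -[[b [i|x]]] //.
    by move=> [b [i|x]] [b' [i'|x']] //= [-> ->].
  + exact: enum_uniq.
  + move=> u; rewrite mem_enum inE (perm_mem s_perm).
    case: u => [u|//]; apply/mapP; case: u => -[b t].
      by exists (b, inl t); rewrite ?mem_enum.
    by exists (b, inr t); rewrite ?mem_enum.
- by rewrite s_path andbT; apply: (@detour_Aodd_ge None (emb false t0)).
- move=> u v neq; case: (eqVneq u None) neq => [->|/Aodd_depth_gt0]; last by lia.
  by rewrite eq_sym => /Aodd_depth_gt0; lia.
Qed.

End Odd.

(** * Closed forms of the depth sums and of [hc] *)

Lemma sum_odd_mul m : 6 * (\sum_(d < m.+1) (2 * d + 1) * d) = m * m.+1 * (4 * m + 5).
Proof.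
elim: m => [|m IHm]; first by rewrite big_ord1.
by rewrite big_ord_recr /= mulnDr IHm; lia.
Qed.

Lemma sum_sqr m : 6 * (\sum_(d < m) 4 * d.+1 ^ 2) = 4 * m * m.+1 * (2 * m + 1).
Proof.
elim: m => [|m IHm]; first by rewrite big_ord0.
by rewrite big_ord_recr /= mulnDr IHm; lia.
Qed.

Local Open Scope ring_scope.

Theorem theorem4 (k : nat) (k_ge1 : (1 <= k)%N) :
  (hc (Aeven k))%:R =
    2%:R / 3%:R * (k%:R - 1)
      * (6%:R * k%:R ^+ 3 + 2%:R * k%:R ^+ 2 - 4%:R * k%:R - 3%:R) :> rat
  /\
  (hc (Aodd k))%:R =
    4%:R / 3%:R * k%:R * (k%:R + 1) * (3%:R * k%:R ^+ 2 + k%:R - 1) + 1 :> rat.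
Proof.
have hc_even := hc_Aeven k_ge1; have hc_odd := hc_Aodd k_ge1.
case: k k_ge1 hc_even hc_odd => // m _ hc_even hc_odd.
have := sum_odd_mul m; have := sum_sqr m.+1; move: hc_even hc_odd.
set S' := (\sum_(d < m.+1) 4 * _)%N; set S := (\sum_(d < m.+1) _)%N.
set a := hc _; set b := hc _.
(* The truncated predecessor is removed before casting to [rat]. The cast equations are then linear
   in [a], [b], [S] and [S'], with the powers of [m] as atoms. *)
have -> : ((2 * m.+1 ^ 2).-1 = 2 * m ^ 2 + 4 * m + 1)%N by lia.
move=> /(congr1 (GRing.natmul (1 : rat))) hc_even.
move=> /(congr1 (GRing.natmul (1 : rat))) hc_odd.
move=> /(congr1 (GRing.natmul (1 : rat))) eS' /(congr1 (GRing.natmul (1 : rat))) eS.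
move: hc_even hc_odd eS' eS.
rewrite -![m.+2]addn1 -![m.+1]addn1 !(GRing.natrD, GRing.natrM, GRing.natrX).
by split; lra.
Qed.
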